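(* Let $k,g>0$, assume that there are no Coriolis effects ($\omega=0$), and let $U\in\mathbb{R}$ be the velocity of the horizontal background current. Let $m=\sqrt{g/k}$, $c=U+m$, and consider the particle parametrized by $(a,b)\in\Sigma:=\mathbb{R}\times(-\infty,0)$, whose path for $t\ge0$ is $$X(t,a,b)=a+(c-m)t-\frac{e^{kb}}{k}\sin(k(a-mt)),\qquad Z(t,a,b)=b+\frac{e^{kb}}{k}\cos(k(a-mt)).$$ Then: (a) If $U=0$, the particle moves clockwise on a circle. (b) If $U>0$ (resp. $U<0$), then the particle moves on a trochoid (resp. on the reflection of a trochoid with respect to a horizontal line). Letting $b_*:=\ln\left((kU^2/g)^{1/(2k)}\right)$, the trochoid is of one of the following types: a prolate cycloid if $b>b_*$; a cycloid if $b=b_*$; a curtate cycloid if $b<b_*$. If instead $m=-\sqrt{g/k}$ (and $c=U+m$), the situation is similar: the particle moves counterclockwise on a circle if $U=0$, and, if $U<0$ (resp. $U>0$), it moves on a trochoid (resp. on a reflected trochoid), of the type determined by $b$ and $b_*$ as in (b).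
   Context: The orientation is that of the $(X,Z)$-plane with the $X$-axis pointing to the right and the $Z$-axis upward. A trochoid is a curve traced by a point at distance $\delta>0$ from the centre of a circle of radius $r>0$ rolling (from below supported) on a fixed horizontal line, i.e. a planar curve of the form $$\{(x_0+r\tau+\delta\sin\tau,\ z_0+\delta\cos\tau):\tau\in\mathbb{R}\},\qquad x_0,z_0\in\mathbb{R}.$$ It is called a curtate cycloid if $\delta<r$, a cycloid (with downward cusps) if $\delta=r$, and a prolate cycloid (with self-intersections) if $\delta>r$. A reflected trochoid is the reflection of a trochoid with respect to a horizontal line; its type is that of the trochoid being reflected. ''The particle moves on a curve'' means that its path, $t\ge0$, is contained in that curve. *)

(* Defs.v *)
From HB Require Import structures.
From mathcomp Require Import all_boot all_order all_algebra.
From mathcomp Require Import all_classical all_reals all_analysis.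
Set Implicit Arguments.
Unset Strict Implicit.
Unset Printing Implicit Defensive.
Import Order.TTheory GRing.Theory Num.Theory.
Import numFieldNormedType.Exports.
Local Open Scope classical_set_scope.
Local Open Scope ring_scope.

(* Points of the plane are pairs (X, Z): X-axis to the right, Z-axis upward. *)

Definition particle_path (R : realType) (k m c a b : R) (t : R) : R * R :=
  (a + (c - m) * t - expR (k * b) / k * sin (k * (a - m * t)),
   b + expR (k * b) / k * cos (k * (a - m * t))).

Definition b_star (R : realType) (k g U : R) : R :=
  ln ((k * U ^+ 2 / g) `^ (1 / (2 * k))).

(* Time is restricted to t >= 0. *)
Definition moves_on (R : realType) (p : R -> R * R) (C : set (R * R)) : Prop :=
  p @` [set t | 0 <= t] `<=` C.

Definition trochoid (R : realType) (x0 z0 r delta : R) : set (R * R) :=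
  range (fun tau : R => (x0 + r * tau + delta * sin tau, z0 + delta * cos tau)).

Definition is_trochoid (R : realType) (C : set (R * R)) : Prop :=
  exists x0 z0 r delta : R,
    [/\ 0 < r, 0 < delta & C = trochoid x0 z0 r delta].

Definition is_curtate_cycloid (R : realType) (C : set (R * R)) : Prop :=
  exists x0 z0 r delta : R,
    [/\ 0 < r, 0 < delta, delta < r & C = trochoid x0 z0 r delta].

Definition is_cycloid (R : realType) (C : set (R * R)) : Prop :=
  exists x0 z0 r delta : R,
    [/\ 0 < r, 0 < delta, delta = r & C = trochoid x0 z0 r delta].

Definition is_prolate_cycloid (R : realType) (C : set (R * R)) : Prop :=
  exists x0 z0 r delta : R,
    [/\ 0 < r, 0 < delta, r < delta & C = trochoid x0 z0 r delta].

(* Image of C under the reflection with respect to the line Z = h. *)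
Definition reflection (R : realType) (h : R) (C : set (R * R)) : set (R * R) :=
  (fun q : R * R => (q.1, 2 * h - q.2)) @` C.

Definition type_by_depth (R : realType) (b bs : R) (C : set (R * R)) : Prop :=
  [/\ bs < b -> is_prolate_cycloid C,
      b = bs -> is_cycloid C
    & b < bs -> is_curtate_cycloid C].

Definition moves_on_trochoid (R : realType) (b bs : R) (p : R -> R * R) : Prop :=
  exists C : set (R * R),
    [/\ is_trochoid C, moves_on p C & type_by_depth b bs C].

(* The type of a reflected trochoid is that of the trochoid C being
   reflected. *)
Definition moves_on_reflected_trochoid (R : realType) (b bs : R)
    (p : R -> R * R) : Prop :=
  exists (C : set (R * R)) (h : R),
    [/\ is_trochoid C, moves_on p (reflection h C) & type_by_depth b bs C].

Definition circle (R : realType) (x0 z0 rho : R) : set (R * R) :=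
  [set q | (q.1 - x0) ^+ 2 + (q.2 - z0) ^+ 2 = rho ^+ 2].

(* phi is a continuous determination, for t >= 0, of the polar angle of p
   about (x0, z0), measured counterclockwise from the positive X-direction.
   Continuity is essential: without it, monotonicity of the angle would not
   determine the sense of rotation. *)
Definition angle_along (R : realType) (x0 z0 rho : R) (p : R -> R * R)
    (phi : R -> R) : Prop :=
  {within `[0, +oo[, continuous phi} /\
  forall t : R, 0 <= t ->
    p t = (x0 + rho * cos (phi t), z0 + rho * sin (phi t)).

Definition moves_clockwise_on_circle (R : realType) (p : R -> R * R) : Prop :=
  exists x0 z0 rho : R,
    [/\ 0 < rho, moves_on p (circle x0 z0 rho)
      & exists2 phi : R -> R, angle_along x0 z0 rho p phi
          & forall s t : R, 0 <= s -> s < t -> phi t < phi s].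

Definition moves_counterclockwise_on_circle (R : realType) (p : R -> R * R)
    : Prop :=
  exists x0 z0 rho : R,
    [/\ 0 < rho, moves_on p (circle x0 z0 rho)
      & exists2 phi : R -> R, angle_along x0 z0 rho p phi
          & forall s t : R, 0 <= s -> s < t -> phi s < phi t].

(* Main.v *)
Require Import Defs.
From mathcomp Require Import all_boot all_order all_algebra.
From mathcomp Require Import all_classical all_reals all_analysis.
From mathcomp Require Import ring.
Import Order.TTheory GRing.Theory Num.Theory.
Import numFieldNormedType.Exports.
Local Open Scope ring_scope.

(* With theta = k (m t - a) and c - m = U, time is an affine function of theta,
   so the path is X = const + (U / (k m)) theta + delta sin theta,
   Z = b + delta cos theta, where delta = expR (k b) / k.  This is a circle if
   U = 0, a trochoid of radius U / (k m) if U / m > 0, and a reflected one if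
   U / m < 0 (substitute tau = pi - theta).  Since m ^+ 2 = g / k, the depth
   b_star is exactly the one where delta equals the radius `|U / (k m)|. *)

(** Squaring doubles the exponent, which cancels the factor [1 / (2 * k)] in [b_star]; [U != 0]
    makes the argument of [ln] positive, so [expR] inverts it. *)
Lemma expR_b_star (R : realType) (k g U : R) : 0 < k -> 0 < g -> U != 0 ->
  expR (k * b_star k g U) ^+ 2 = k * U ^+ 2 / g.
Proof.
move=> k0 g0 U0; rewrite /b_star ln_powR -expRM_natl.
have -> : 2%:R * (k * (1 / (2 * k) * ln (k * U ^+ 2 / g))) =
    ln (k * U ^+ 2 / g).
  by field; rewrite gt_eqF.
by rewrite lnK// posrE divr_gt0// mulr_gt0// exprn_even_gt0.
Qed.

(** Both sides are nonnegative and have square [U ^+ 2 / (k * g)]. *)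
Lemma b_star_radius (R : realType) (k g U m : R) :
  0 < k -> 0 < g -> U != 0 -> m ^+ 2 = g / k ->
  expR (k * b_star k g U) / k = `|U / (k * m)|.
Proof.
move=> k0 g0 U0 m2.
have m0 : m != 0 by rewrite -sqrf_eq0 m2 gt_eqF// divr_gt0.
apply: (@pexpIrn R 2) => //; rewrite ?nnegrE ?normr_ge0//.
  by rewrite divr_ge0 ?expR_ge0// ltW.
rewrite real_normK ?num_real// !expr_div_n exprMn m2 expR_b_star//.
by field; rewrite !gt_eqF.
Qed.

(** Since [expR (k * x) / k] increases strictly with [x], comparing [b] with [bs] amounts to
    comparing delta with the radius. *)
Lemma type_by_depth_trochoid (R : realType) (k b bs x0 z0 : R) : 0 < k ->
  type_by_depth b bs (trochoid x0 z0 (expR (k * bs) / k) (expR (k * b) / k)).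
Proof.
move=> k0; have e0 x : 0 < expR (k * x) / k by rewrite divr_gt0 ?expR_gt0.
split=> hb; exists x0, z0, (expR (k * bs) / k), (expR (k * b) / k); split=> //.
- by rewrite ltr_pM2r ?invr_gt0// ltr_expR ltr_pM2l.
- by rewrite hb.
- by rewrite ltr_pM2r ?invr_gt0// ltr_expR ltr_pM2l.
Qed.

Lemma particle_moves_on_trochoid (R : realType) (k g U m a b : R) :
  0 < k -> 0 < g -> m ^+ 2 = g / k -> 0 < U / m ->
  moves_on_trochoid b (b_star k g U) (particle_path k m (U + m) a b).
Proof.
move=> k0 g0 m2 Um.
have m0 : m != 0 by rewrite -sqrf_eq0 m2 gt_eqF// divr_gt0.
have U0 : U != 0 by apply: contraTneq Um => ->; rewrite mul0r ltxx.
have kU : 0 < U / (k * m) by rewrite invfM mulrCA mulr_gt0 ?invr_gt0.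
have rE : expR (k * b_star k g U) / k = U / (k * m).
  by rewrite (@b_star_radius _ _ _ _ m)// gtr0_norm.
(* From theta = k (m t - a) one gets t = a / m + theta / (k m), so a + U t has constant term
   [a + a * U / m]. *)
exists (trochoid (a + a * U / m) b (expR (k * b_star k g U) / k)
  (expR (k * b) / k)); split; last exact: type_by_depth_trochoid.
  by do 4 eexists; split; last reflexivity; rewrite divr_gt0 ?expR_gt0.
move=> _ [t _ <-]; exists (- (k * (a - m * t))) => //.
rewrite /particle_path sinN cosN rE; congr (_, _).
by field; rewrite m0 gt_eqF.
Qed.

Lemma particle_moves_on_reflected_trochoid (R : realType) (k g U m a b : R) :
  0 < k -> 0 < g -> m ^+ 2 = g / k -> U / m < 0 ->
  moves_on_reflected_trochoid b (b_star k g U) (particle_path k m (U + m) a b).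
Proof.
move=> k0 g0 m2 Um.
have m0 : m != 0 by rewrite -sqrf_eq0 m2 gt_eqF// divr_gt0.
have U0 : U != 0 by apply: contraTneq Um => ->; rewrite mul0r ltxx.
have kU : U / (k * m) < 0 by rewrite invfM mulrCA pmulr_rlt0 ?invr_gt0.
have rE : expR (k * b_star k g U) / k = - (U / (k * m)).
  by rewrite (@b_star_radius _ _ _ _ m)// ltr0_norm.
(* The radius is now [- (U / (k * m))]; the extra term in [pi] offsets the half-turn in tau = s +
   pi, which flips both sine and cosine. Reflecting in Z = b restores the cosine. *)
exists (trochoid (a + a * U / m + U / (k * m) * pi) b
  (expR (k * b_star k g U) / k) (expR (k * b) / k)), b.
split; last exact: type_by_depth_trochoid.
  by do 4 eexists; split; last reflexivity; rewrite divr_gt0 ?expR_gt0.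
move=> _ [t _ <-]; set s := k * (a - m * t).
eexists; first by exists (s + pi).
rewrite /particle_path /= sinDpi cosDpi rE -/s; congr (_, _); last by ring.
by rewrite /s; field; rewrite m0 gt_eqF.
Qed.

(** With c = m the drift vanishes, and a quarter-turn converts (- sin, cos) into (cos, sin). The
    angle has slope - k m, so the sign of [m] decides the sense of rotation. *)
Lemma particle_angle_along (R : realType) (k m a b : R) :
  angle_along a b (expR (k * b) / k) (particle_path k m m a b)
    (fun t => k * (a - m * t) + pi / 2).
Proof.
split.
  apply: continuous_subspaceT => t.
  apply: cvgD; last exact: cvg_cst.
  apply: cvgM; first exact: cvg_cst.
  apply: cvgB; first exact: cvg_cst.
  by apply: cvgM; [exact: cvg_cst | exact: cvg_id].
move=> t _; rewrite /particle_path cosDpihalf sinDpihalf.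
by congr (_, _); ring.
Qed.

Lemma angle_along_moves_on_circle (R : realType) (x0 z0 rho : R) p phi :
  angle_along x0 z0 rho p phi -> moves_on p (circle x0 z0 rho).
Proof.
move=> [_ pE] _ [t t0 <-]; rewrite pE// /circle /=.
by rewrite ![_ + _ * _ - _]addrAC !subrr !add0r !exprMn -mulrDr cos2Dsin2 mulr1.
Qed.

Theorem proposition4p2 (R : realType) (k g U a b : R)
    (hk : 0 < k) (hg : 0 < g) (hb : b < 0) :
  (forall m c : R, m = Num.sqrt (g / k) -> c = U + m ->
    [/\ U = 0 -> moves_clockwise_on_circle (particle_path k m c a b),
        0 < U ->
          moves_on_trochoid b (b_star k g U) (particle_path k m c a b)
      & U < 0 ->
          moves_on_reflected_trochoid b (b_star k g U)
            (particle_path k m c a b)])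
  /\
  (forall m c : R, m = - Num.sqrt (g / k) -> c = U + m ->
    [/\ U = 0 -> moves_counterclockwise_on_circle (particle_path k m c a b),
        U < 0 ->
          moves_on_trochoid b (b_star k g U) (particle_path k m c a b)
      & 0 < U ->
          moves_on_reflected_trochoid b (b_star k g U)
            (particle_path k m c a b)]).
Proof.
have sq : 0 < Num.sqrt (g / k) by rewrite sqrtr_gt0 divr_gt0.
have sq2 : Num.sqrt (g / k) ^+ 2 = g / k by rewrite sqr_sqrtr// ltW// divr_gt0.
have rho0 : 0 < expR (k * b) / k by rewrite divr_gt0 ?expR_gt0.
split=> m c mE ->.
- have m0 : 0 < m by rewrite mE.
  have m2 : m ^+ 2 = g / k by rewrite mE.
  split=> hU.
  + rewrite hU add0r; have ang := @particle_angle_along R k m a b.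
    exists a, b, (expR (k * b) / k); split=> //.
      exact: angle_along_moves_on_circle ang.
    exists (fun t => k * (a - m * t) + pi / 2) => // s t _ st.
    by rewrite ltrD2r ltr_pM2l// ltrD2l ltrN2 ltr_pM2l.
  + by apply: particle_moves_on_trochoid => //; rewrite divr_gt0.
  + by apply: particle_moves_on_reflected_trochoid => //;
      rewrite pmulr_llt0 ?invr_gt0.
- have m0 : m < 0 by rewrite mE oppr_lt0.
  have m2 : m ^+ 2 = g / k by rewrite mE sqrrN.
  split=> hU.
  + rewrite hU add0r; have ang := @particle_angle_along R k m a b.
    exists a, b, (expR (k * b) / k); split=> //.
      exact: angle_along_moves_on_circle ang.
    exists (fun t => k * (a - m * t) + pi / 2) => // s t _ st.
    by rewrite ltrD2r ltr_pM2l// ltrD2l ltrN2 ltr_nM2l.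
  (* As m < 0, U / m has the sign opposite to U, which swaps the two trochoid cases. *)
  + by apply: particle_moves_on_trochoid => //; rewrite nmulr_lgt0 ?invr_lt0.
  + by apply: particle_moves_on_reflected_trochoid => //;
      rewrite nmulr_llt0 ?invr_lt0.
Qed.
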